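(* Let $R$ be a finite local ring with maximal ideal $M$ of order $m$. (a) If $|R|/m\equiv 1 \pmod 4$, then the spectrum of $\mathcal{G}_R$ consists of the eigenvalue $\frac{|R|-m}{2}$ with multiplicity $1$, the eigenvalue $\frac{m(-1+\sqrt{|R|/m})}{2}$ with multiplicity $(|R|/m-1)/2$, the eigenvalue $\frac{m(-1-\sqrt{|R|/m})}{2}$ with multiplicity $(|R|/m-1)/2$, and the eigenvalue $0$ with multiplicity $|R|-|R|/m$. (b) If $|R|/m\equiv 3 \pmod 4$, then the spectrum of $\mathcal{G}_R$ consists of the eigenvalue $|R|-m$ with multiplicity $1$, the eigenvalue $-m$ with multiplicity $|R|/m-1$, and the eigenvalue $0$ with multiplicity $|R|-|R|/m$.
   Context: All rings are finite commutative rings with identity $1\neq 0$; a local ring is one with a unique maximal ideal. For such a ring $R$, $R^\times$ is its unit group, $Q_R=\{u^2:u\in R^\times\}$, $T_R=Q_R\cup(-Q_R)$, and the quadratic unitary Cayley graph $\mathcal{G}_R$ has vertex set $R$ with $x,y$ adjacent iff $x-y\in T_R$. The eigenvalues (spectrum) of a graph are those of its adjacency matrix, with multiplicities. *)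

(* Defs.v *)
From HB Require Import structures.
From mathcomp Require Import all_boot all_order all_algebra.

Set Implicit Arguments.
Unset Strict Implicit.
Unset Printing Implicit Defensive.

Import Order.TTheory GRing.Theory Num.Theory.
Local Open Scope ring_scope.

(* [idealr_closed] includes [1 \notin I], so the ideals quantified over here
   are the proper ones. *)
Definition maximal_ideal (R : finComUnitRingType) (M : {set R}) : Prop :=
  idealr_closed M /\
  forall J : {set R}, idealr_closed J -> M \subset J -> J = M.

Definition local_ring (R : finComUnitRingType) : Prop :=
  exists! M : {set R}, maximal_ideal M.

Definition unit_squares (R : finComUnitRingType) : {set R} :=
  [set u ^+ 2 | u : R & u \is a GRing.unit].

Definition signed_unit_squares (R : finComUnitRingType) : {set R} :=
  unit_squares R :|: [set - x | x in unit_squares R].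

Definition quadratic_unitary_cayley (R : finComUnitRingType) : rel R :=
  [rel x y | x - y \in signed_unit_squares R].

(* The vertices are ordered by [enum V]; the spectrum does not depend on this
   choice. *)
Definition adjacency_mx (F : nzRingType) (V : finType) (e : rel V) :
    'M[F]_#|V| :=
  \matrix_(i, j) (e (enum_val i) (enum_val j))%:R.

(* The sequence [s], up to order, lists all the eigenvalues of the graph [e],
   each repeated according to its multiplicity. *)
Definition has_spectrum (F : fieldType) (V : finType) (e : rel V)
    (s : seq F) : Prop :=
  char_poly (adjacency_mx F e) = \prod_(a <- s) ('X - a%:P).

(* Main.v *)
(* Let n = |R|, q = n / m, and let J, K, S be the matrices whose (x, y) entry is
   1, the indicator of x - y in M, and chi (x - y), where chi is the quadratic
   character of the residue field (0 on M). When q is odd, every element of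
   1 + M is a square, so chi detects exactly the squares of units. The Jacobsthal
   sum sum_y chi y chi (z - y) gives S^2 = chi(-1) (n K - m J), while S J = 0,
   S K = m S, K^2 = m K, K J = m J and J^2 = n J. If q = 1 mod 4 then -1 is a
   square and the adjacency matrix is (J - K + S) / 2; if q = 3 mod 4 it is J - K.
   Both decompose along orthogonal idempotents that are combinations of J, K, S
   and 1, and in characteristic zero the multiplicity of each eigenvalue is the
   trace of its idempotent. *)

Require Import Defs.
From HB Require Import structures.
From mathcomp Require Import all_boot all_order all_algebra all_fingroup.
From mathcomp Require Import all_solvable ring.

Set Implicit Arguments.
Unset Strict Implicit.
Unset Printing Implicit Defensive.

Import Order.TTheory GRing.Theory Num.Theory.
Local Open Scope ring_scope.

(** * Linear algebra: characteristic polynomials from orthogonal idempotents *)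

Lemma det_1addmx_mul (R : comPzRingType) (m n : nat) (A : 'M[R]_(m, n))
    (B : 'M[R]_(n, m)) :
  \det (1%:M + A *m B) = \det (1%:M + B *m A).
Proof.
(* Both sides equal the block matrix with rows [1 + A B, A] and [B, 1], factored in two ways through
   block triangular matrices; comparing determinants gives the claim. *)
have eq_block : block_mx 1%:M 0 B 1%:M *m block_mx (1%:M + A *m B) A 0 1%:M =
    block_mx 1%:M A 0 (1%:M + B *m A) *m block_mx 1%:M 0 B 1%:M :> 'M_(m + n).
  by rewrite !mulmx_block !(mul1mx, mul0mx, mulmx0, mulmx1, addr0, add0r)
    mulmxDr mulmxDl mulmx1 mul1mx mulmxA [B *m A + _]addrC.
by have := congr1 determinant eq_block;
  rewrite !det_mulmx det_ublock !det_lblock det_ublock !det1 !mul1r !mulr1.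
Qed.

Section Idempotents.
Variables (F : fieldType) (n : nat).
Implicit Types (E : 'M[F]_n) (s : seq (F * 'M[F]_n)).

(** With [E = C B] for [C = col_base E] and [B = row_base E], idempotence reads [C (B C) B = C B],
    where [C] cancels on the left and [B] on the right. *)
Lemma idempotent_base E :
  E *m E = E -> row_base E *m col_base E = 1%:M.
Proof.
move=> idemE; apply: (row_free_inj (row_base_free E)).
apply: (row_full_inj (col_base_full E)).
by rewrite /= mul1mx -[row_base E *m _ *m _]mulmxA mulmx_base mulmxA mulmx_base.
Qed.

Lemma mxtrace_idempotent E : E *m E = E -> \tr E = (\rank E)%:R.
Proof.
by move=> idemE; rewrite -{1}[E]mulmx_base mxtrace_mulC idempotent_base //
  mxtrace1.
Qed.

(** Swapping the two factors of the rank factorization by [det_1addmx_mul] leaves a scalar matrix of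
    size [\rank E]. *)
Lemma det_1add_idempotent E (c : {poly F}) : E *m E = E ->
  \det (1%:M + c *: map_mx polyC E) = (1 + c) ^+ \rank E.
Proof.
move=> idemE; rewrite -{1}[E]mulmx_base map_mxM scalemxAl det_1addmx_mul.
rewrite -scalemxAr -map_mxM idempotent_base // map_scalar_mx /= scale_scalar_mx.
by rewrite mulr1 -raddfD /= det_scalar.
Qed.

(** Products are asked to vanish in list order, the order in which the head of the list is split off
    below. *)
Definition orthogonal_idempotents s : bool :=
  all (fun p => p.2 *m p.2 == p.2) s &&
  pairwise (fun p q => p.2 *m q.2 == 0) s.

(** Orthogonality kills the cross term in the product of the head factor with the factor of the
    tail, so the determinant splits by induction. *)
Lemma det_1add_orthogonal s (c : F -> {poly F}) : orthogonal_idempotents s ->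
  \det (1%:M + \sum_(p <- s) c p.1 *: map_mx polyC p.2) =
  \prod_(p <- s) (1 + c p.1) ^+ \rank p.2.
Proof.
elim: s => [|[a E] s IHs]; first by rewrite !big_nil addr0 det1.
case/andP=> /= /andP[/eqP idemE idem_s] /andP[/allP orthE orth_s].
rewrite !big_cons /= -IHs; last by rewrite /orthogonal_idempotents idem_s.
rewrite -det_1add_idempotent // -det_mulmx.
rewrite mulmxDl mul1mx mulmxDr mulmx1.
have -> : (c a *: map_mx polyC E) *m
    (\sum_(p <- s) c p.1 *: map_mx polyC p.2) = 0.
  rewrite mulmx_sumr big1_seq // => p /andP[_ /orthE/eqP Ep0].
  by rewrite -scalemxAl -scalemxAr -map_mxM Ep0 map_mx0 !scaler0.
by rewrite addr0 [c a *: _ + _]addrC addrA.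
Qed.

Lemma char_poly_orthogonal s : orthogonal_idempotents s ->
    \sum_(p <- s) p.2 = 1%:M ->
  char_poly (\sum_(p <- s) p.1 *: p.2) =
  \prod_(p <- s) ('X - p.1%:P) ^+ \rank p.2.
Proof.
move=> orth_s sum_s; rewrite /char_poly /char_poly_mx.
(* Chosen so that [1 + c a = 'X - a]; as the idempotents sum to 1, the characteristic matrix becomes
   1 plus a combination of them. *)
pose c a : {poly F} := 'X - a%:P - 1.
transitivity (\det (1%:M + \sum_(p <- s) c p.1 *: map_mx polyC p.2)); last first.
  by rewrite det_1add_orthogonal //; apply: eq_bigr => p _; rewrite /c addrC subrK.
have sum_sC : \sum_(p <- s) map_mx polyC p.2 = 1%:M.
  by have := congr1 (map_mx polyC) sum_s; rewrite raddf_sum map_scalar_mx.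
congr (\det _); rewrite raddf_sum.
rewrite -{1}(mulr1 'X) -scale_scalar_mx -sum_sC scaler_sumr -big_split -sumrB /=.
apply: eq_bigr => p _; rewrite map_mxZ /c !scalerBl scale1r.
by rewrite addrCA subrr addr0.
Qed.

End Idempotents.

Lemma rank_orthogonal (F : numFieldType) (n : nat) (s : seq (F * 'M[F]_n))
    (a : F) (E : 'M[F]_n) (k : nat) :
  orthogonal_idempotents s -> (a, E) \in s -> \tr E = k%:R -> \rank E = k.
Proof.
case/andP=> /allP idem_s _ /idem_s/eqP/mxtrace_idempotent ->.
by move/eqP; rewrite eqr_nat => /eqP.
Qed.

(** * Convolution matrices on a finite abelian group *)

Section Convolution.
Variables (F : comNzRingType) (V : finZmodType).
Implicit Types f g : V -> F.

(** Convolution operators: a Cayley graph has such an adjacency matrix, with [f] the indicator of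
    its connection set. *)
Definition difference_mx f : 'M[F]_#|V| :=
  \matrix_(i, j) f (enum_val i - enum_val j).

Lemma sum_difference f (x : V) : \sum_y f (x - y) = \sum_y f y.
Proof.
by rewrite [RHS](reindex_inj (inv_inj (subKr x))).
Qed.

Lemma difference_mxM f g :
  difference_mx f *m difference_mx g =
  difference_mx (fun x => \sum_y f y * g (x - y)).
Proof.
apply/matrixP=> i k; rewrite !mxE.
under eq_bigr do rewrite !mxE.
rewrite -(sum_difference _ (enum_val i)).
rewrite [RHS](reindex (@enum_val _ V)) /=; last exact/onW_bij/enum_val_bij.
by apply: eq_bigr => y _; congr (_ * g _); rewrite opprB [RHS]addrC subrKA.
Qed.

Lemma difference_mxC f g :
  difference_mx f *m difference_mx g = difference_mx g *m difference_mx f.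
Proof.
rewrite !difference_mxM; apply/matrixP=> i j; rewrite !mxE.
rewrite -[RHS](sum_difference _ (enum_val i - enum_val j)).
by apply: eq_bigr => y _; rewrite subKr mulrC.
Qed.

Lemma mxtrace_difference f : \tr (difference_mx f) = #|V|%:R * f 0.
Proof.
rewrite /mxtrace; under eq_bigr do rewrite mxE subrr.
by rewrite sumr_const card_ord mulr_natl.
Qed.

End Convolution.

(** * In a local ring the maximal ideal is the set of nonunits *)

Lemma maximal_ideal_nonunit (R : finComUnitRingType) (M : {set R}) (x : R) :
  local_ring R -> maximal_ideal M -> (x \in M) = (x \isn't a GRing.unit).
Proof.
case=> M' [_ uniqM'] maxM; have [[M0 M1 Mlin] _] := maxM.
apply/idP/idP=> [Mx | nUx].
  apply/negP => Ux; case/negP: M1.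
  by rewrite -(mulVr Ux) -[_ * _]addr0; apply: Mlin.
(* A boolean form of properness and closure lets [maxset_exists] produce a maximal ideal by
   finiteness. *)
pose idealb (J : {set R}) := [&& 0 \in J, 1 \notin J &
  [forall a, forall u in J, forall v in J, a * u + v \in J]].
have idealP (J : {set R}) : reflect (idealr_closed J) (idealb J).
  apply: (iffP and3P) => [] [J0 J1 Jlin]; split=> //.
    move=> a u v Ju Jv.
    by move/forallP/(_ a)/forall_inP/(_ u Ju)/forall_inP: Jlin; apply.
  apply/forallP=> a; apply/forall_inP=> u Ju; apply/forall_inP=> v.
  exact: Jlin.
(* The principal ideal of a nonunit is proper; a maximal ideal containing it must be [M] by
   uniqueness. *)
pose I := [set a * x | a : R].
have idI : idealb I.
  apply/idealP; split.
  - by apply/imsetP; exists 0; rewrite ?mul0r.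
  - apply/imsetP=> -[a _ ax]; case/negP: nUx; apply/unitrPr; exists a.
    by rewrite mulrC.
  - move=> a _ _ /imsetP[b _ ->] /imsetP[c _ ->]; apply/imsetP.
    by exists (a * b + c); rewrite ?mulrDl ?mulrA.
have [J maxJ IJ] := maxset_exists idI.
have maxJ' : maximal_ideal J.
  split; first exact/idealP/(maxsetp maxJ).
  by move=> J' /idealP; apply: maxsetsup.
rewrite -(uniqM' _ maxM) (uniqM' _ maxJ'); apply: (subsetP IJ).
by apply/imsetP; exists 1; rewrite ?mul1r.
Qed.

(** * Units and squares of units in a local ring *)

Section LocalRing.
Variables (R : finComUnitRingType) (M : {set R}).
Hypothesis idealM : idealr_closed M.
Hypothesis nonunitM : forall x, (x \in M) = (x \isn't a GRing.unit).
Local Notation Q := (unit_squares R).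

Lemma ideal0 : 0 \in M. Proof. by case: idealM. Qed.

Lemma ideal1 : 1 \notin M. Proof. by case: idealM. Qed.

Lemma idealMl a x : x \in M -> a * x \in M.
Proof.
by case: idealM => M0 _ Mlin Mx; rewrite -[_ * _]addr0; apply: Mlin.
Qed.

Lemma idealD x y : x \in M -> y \in M -> x + y \in M.
Proof. by case: idealM => _ _ Mlin Mx; rewrite -[x]mul1r; apply: Mlin. Qed.

Lemma idealN x : (- x \in M) = (x \in M).
Proof.
by apply/idP/idP=> /(idealMl (-1)); rewrite mulN1r ?opprK.
Qed.

Lemma idealB x y : x \in M -> y \in M -> x - y \in M.
Proof. by move=> Mx My; rewrite idealD ?idealN. Qed.

Lemma idealDr x y : y \in M -> (x + y \in M) = (x \in M).
Proof.
move=> My; apply/idP/idP=> [Mxy | Mx]; last exact: idealD.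
by rewrite -(addrK y x) idealB.
Qed.

Lemma unitDr x y : y \in M -> (x + y \is a GRing.unit) = (x \is a GRing.unit).
Proof. by move=> My; apply: negb_inj; rewrite -!nonunitM idealDr. Qed.

Lemma ideal_group_set : group_set M.
Proof. by apply/group_setP; split; [exact: ideal0 | exact: idealD]. Qed.

Lemma card_ideal_dvdn : (#|M| %| #|R|)%N.
Proof. by rewrite -cardsT; have := cardSg (subsetT (Group ideal_group_set)). Qed.

Lemma card_ideal_gt0 : (0 < #|M|)%N.
Proof. by apply/card_gt0P; exists 0; exact: ideal0. Qed.

Lemma card_unit : #|[set x : R | x \is a GRing.unit]| = (#|R| - #|M|)%N.
Proof.
rewrite -(cardsC M) addKn; apply: eq_card => x.
by rewrite !inE nonunitM negbK.
Qed.

(** By Lagrange in the additive group [R / M], the index times 1 lies in [M]. If 2 were in [M],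
    oddness of the index would put 1 in [M]. *)
Lemma unit2_of_odd_index : odd (#|R| %/ #|M|) -> (2 : R) \is a GRing.unit.
Proof.
move=> odd_q; apply: contraNT ideal1; rewrite -nonunitM => M2.
pose G := Group ideal_group_set.
have nGR : [set: R]%G \subset 'N(G)%g.
  by rewrite sub_abelian_norm ?FinRing.zmod_abelian ?subsetT.
have: (coset G (1%R : R) ^+ (#|R| %/ #|M|) = 1)%g.
  have -> : (#|R| %/ #|M|)%N = #|[set: R] / G|%g.
    by rewrite card_quotient // -divgS ?subsetT //= cardsT.
  by apply: expg_cardG; rewrite mem_quotient ?inE.
have N1 : (1 : R) \in 'N(G)%g by rewrite (subsetP nGR) ?inE.
rewrite -morphX //= => coset1; have := coset_idr (groupX _ N1) coset1.
rewrite FinRing.zmodXgE -(odd_double_half (#|R| %/ #|M|)) odd_q.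
rewrite mulrS -muln2 mulnC mulrnA -[_ *+ _./2]mulr_natl idealDr //.
exact: idealMl.
Qed.

Hypothesis unit2 : (2 : R) \is a GRing.unit.

(** Otherwise Cauchy gives an element of additive order 2, which the unit 2 would annihilate. *)
Lemma odd_card_ideal : odd #|M|.
Proof.
rewrite -[odd _]negbK -dvdn2; apply/negP=> dvd2M.
have [//|x _ ord_x] := Cauchy (G := Group ideal_group_set) (p := 2) _ dvd2M.
have := expg_order x; rewrite ord_x FinRing.zmodXgE -mulr_natl => x2.
have x0 : x = 0 by rewrite -(mulKr unit2 x) x2 mulr0.
by move: ord_x; rewrite x0 -[0]FinRing.zmod1gE order1.
Qed.

(** The factors [x - 1] and [x + 1] differ by the unit 2, so they are not both in [M], and the one
    that is a unit forces the other to vanish. *)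
Lemma sqr_eq1_local (x : R) : x ^+ 2 = 1 -> x = 1 \/ x = -1.
Proof.
move=> x2; have xx : (x - 1) * (x + 1) = 0 by rewrite -subr_sqr_1 x2 subrr.
have [Ux | nUx] := boolP (x - 1 \is a GRing.unit).
  right; apply/eqP; rewrite -subr_eq0 opprK; apply/eqP.
  by rewrite -(mulKr Ux (x + 1)) xx mulr0.
left; apply/eqP; rewrite -subr_eq0; apply/eqP.
have Ux1 : x + 1 \is a GRing.unit.
  have -> : x + 1 = 2 + (x - 1) by ring.
  by rewrite unitDr // nonunitM.
by rewrite -(mulrK Ux1 (x - 1)) xx mul0r.
Qed.

Lemma unit_squareP x :
  reflect (exists2 u, u \is a GRing.unit & x = u ^+ 2) (x \in Q).
Proof.
by apply: (iffP imsetP) => -[u Uu ->]; exists u; move: Uu; rewrite ?inE.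
Qed.

Lemma unit_square_unit x : x \in Q -> x \is a GRing.unit.
Proof. by case/unit_squareP=> u Uu ->; rewrite unitrX. Qed.

Lemma unit_square1 : 1 \in Q.
Proof. by apply/unit_squareP; exists 1; rewrite ?unitr1 ?expr1n. Qed.

Lemma unit_squareM x y : x \in Q -> y \in Q -> x * y \in Q.
Proof.
case/unit_squareP=> u Uu -> /unit_squareP[v Uv ->].
by apply/unit_squareP; exists (u * v); rewrite ?unitrM ?Uu ?exprMn.
Qed.

Lemma unit_squareV x : x \in Q -> x^-1 \in Q.
Proof.
case/unit_squareP=> u Uu ->.
by apply/unit_squareP; exists u^-1; rewrite ?unitrV ?exprVn.
Qed.

Lemma unit_squareMr x y : x \in Q -> (x * y \in Q) = (y \in Q).
Proof.
move=> Qx; apply/idP/idP=> [|Qy]; last exact: unit_squareM.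
by move/(unit_squareM (unit_squareV Qx)); rewrite mulKr ?unit_square_unit.
Qed.

Lemma neq_opp_unit (x : R) : x \is a GRing.unit -> x != - x.
Proof.
move=> Ux; rewrite -addr_eq0 -mulr2n -mulr_natl.
apply/eqP=> x2; have: 2 * x \is a GRing.unit by rewrite unitrM unit2.
by rewrite x2 unitr0.
Qed.

(** Each fibre of squaring on the units is a pair [{u, -u}]. *)
Lemma card_unit_squares :
  (#|Q|.*2 = #|[set x : R | x \is a GRing.unit]|)%N.
Proof.
rewrite -[RHS]sum1_card (partition_big (fun u => u ^+ 2) (mem Q)) /=; last first.
  by move=> u; rewrite inE => Uu; apply/unit_squareP; exists u.
rewrite -muln2 -sum_nat_const; apply: eq_bigr => _ /unit_squareP[u Uu ->].
transitivity #|[set u; - u]|; first by rewrite cards2 neq_opp_unit.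
rewrite sum1_card; apply: eq_card => v; rewrite !inE.
apply/idP/andP=> [/orP[]/eqP-> | [Uv /eqP uv]].
- by rewrite inE.
- by rewrite inE unitrN sqrrN.
have /sqr_eq1_local[] : (v / u) ^+ 2 = 1.
- by rewrite exprMn exprVn uv divrr ?unitrX.
- by move/(canRL (divrK Uu)); rewrite mul1r => ->; rewrite eqxx.
- by move/(canRL (divrK Uu)); rewrite mulN1r => ->; rewrite eqxx orbT.
Qed.

(* Squaring is injective on the finite set 1 + M, hence onto it. *)
Lemma one_add_ideal_square z : z \in M -> 1 + z \in Q.
Proof.
pose f w : R := (1 + w) ^+ 2 - 1.
have U1 w : w \in M -> 1 + w \is a GRing.unit.
  by move=> Mw; rewrite unitDr ?unitr1.
have f_inj : {in M &, injective f}.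
  move=> w w' Mw Mw' /addIr /eqP; rewrite -subr_eq0 => /eqP.
  have -> : (1 + w) ^+ 2 - (1 + w') ^+ 2 = (2 + (w + w')) * (w - w') by ring.
  have Uww : 2 + (w + w') \is a GRing.unit by rewrite unitDr ?idealD.
  move/(congr1 ( *%R (2 + (w + w'))^-1)); rewrite mulKr // mulr0.
  by move/eqP; rewrite subr_eq0 => /eqP.
have fM : f @: M = M.
  apply/eqP; rewrite eqEcard card_in_imset // leqnn andbT.
  apply/subsetP=> _ /imsetP[w Mw ->].
  have -> : f w = (2 + w) * w by rewrite /f; ring.
  exact: idealMl.
rewrite -{1}fM => /imsetP[w Mw ->]; apply/unit_squareP.
exists (1 + w); first exact: U1.
by rewrite /f addrC subrK.
Qed.

(** For a unit [y], [y + w = y * (1 + y^-1 * w)], and the second factor is a square when [w] is in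
    [M]. *)
Lemma unit_squareDr x z : z \in M -> (x + z \in Q) = (x \in Q).
Proof.
have sub y w : w \in M -> y \in Q -> y + w \in Q.
  move=> Mw Qy; have Uy := unit_square_unit Qy.
  have -> : y + w = y * (1 + y^-1 * w) by rewrite mulrDr mulr1 mulVKr.
  by rewrite unit_squareM ?one_add_ideal_square ?idealMl.
move=> Mz; apply/idP/idP=> [Qxz | Qx]; last exact: sub.
by rewrite -(addrK z x); apply: sub; rewrite ?idealN.
Qed.

(** Squares are half of the units, so the coset [x Q] fills the nonsquare units; a nonsquare
    [y = x z] gives [x y = x ^+ 2 * z]. *)
Lemma mul_nonsquare x y : x \is a GRing.unit -> y \is a GRing.unit ->
  x \notin Q -> (x * y \in Q) = (y \notin Q).
Proof.
move=> Ux Uy nQx; have [Qy | nQy] /= := boolP (y \in Q).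
  by rewrite mulrC unit_squareMr // (negPf nQx).
pose U := [set z : R | z \is a GRing.unit].
have xQ : [set x * z | z in Q] = U :\: Q.
  apply/eqP; rewrite eqEcard card_imset; last exact: (can_inj (mulKr Ux)).
  have QU : Q \subset U by apply/subsetP=> z /unit_square_unit; rewrite inE.
  rewrite cardsD (setIidPr QU) -card_unit_squares -addnn addnK leqnn andbT.
  apply/subsetP=> _ /imsetP[z Qz ->].
  by rewrite !inE mulrC unit_squareMr // nQx unitrM Ux unit_square_unit.
have: y \in U :\: Q by rewrite !inE nQy.
rewrite -xQ => /imsetP[z Qz ->]; rewrite mulrA -expr2 unit_squareM //.
by apply/unit_squareP; exists x.
Qed.

(** A copy of [Q] inside the multiplicative group [{unit R}], where Lagrange and Cauchy apply. *)
Let squares : {set {unit R}} := [set u | val u \in Q].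

Lemma squares_group_set : group_set squares.
Proof.
apply/group_setP; split; first by rewrite inE unit_square1.
by move=> u v; rewrite !inE; apply: unit_squareM.
Qed.

Lemma card_squares : #|squares| = #|Q|.
Proof.
rewrite -(card_imset _ val_inj); apply: eq_card => x.
apply/imsetP/idP=> [[u + ->] | Qx]; first by rewrite inE.
by exists (FinRing.unit R (unit_square_unit Qx)); rewrite ?inE.
Qed.

(** The only unit of order 2 is -1, so it belongs to the subgroup of squares exactly when that
    subgroup has even order. *)
Lemma unit_squareN1 : (-1 \in Q) = ~~ odd #|Q|.
Proof.
rewrite -card_squares -dvdn2; apply/idP/idP=> [QN1 | dvd2Q].
  pose u := FinRing.unit R (unit_square_unit QN1).
  suff <- : #[u]%g = 2%N.
    by apply: (order_dvdG (G := Group squares_group_set)); rewrite inE.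
  apply/nt_prime_order => //; first by apply/val_inj; rewrite /= mulrNN mulr1.
  by rewrite -val_eqE /= eq_sym neq_opp_unit ?unitr1.
have [//|u] := Cauchy (G := Group squares_group_set) (p := 2) _ dvd2Q.
rewrite inE => Qu ord_u; have := expg_order u; rewrite ord_u => /(congr1 val) u2.
have /sqr_eq1_local[u1 | <- //] : (val u) ^+ 2 = 1 by exact: u2.
by move: ord_u; rewrite (_ : u = 1%g) ?order1 //; apply/val_inj.
Qed.


(** * The quadratic character and its Jacobsthal sum *)

Variable F : numFieldType.

Definition quad_char (x : R) : F :=
  if x \is a GRing.unit then (-1) ^+ (x \notin Q) else 0.
Local Notation chi := quad_char.

Lemma quad_char_ideal x : x \in M -> chi x = 0.
Proof. by rewrite nonunitM /quad_char => /negPf->. Qed.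

Lemma quad_charM x y : chi (x * y) = chi x * chi y.
Proof.
rewrite /quad_char unitrM.
have [Ux | _] := boolP (x \is a GRing.unit); last by rewrite mul0r.
have [Uy | _] := boolP (y \is a GRing.unit); last by rewrite mulr0.
rewrite -signr_addb; have [Qx | nQx] := boolP (x \in Q).
  by rewrite unit_squareMr.
by rewrite mul_nonsquare // negbK; case: (y \in Q).
Qed.

Lemma quad_charDr x z : z \in M -> chi (x + z) = chi x.
Proof. by move=> Mz; rewrite /quad_char unitDr // unit_squareDr. Qed.

Lemma quad_char_sqr x : x \is a GRing.unit -> chi x * chi x = 1.
Proof. by move=> Ux; rewrite /quad_char Ux -signr_addb addbb. Qed.

Lemma sum_mem (A : {set R}) : \sum_x (x \in A)%:R = #|A|%:R :> F.
Proof.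
by rewrite -natr_sum -sum1_card [in RHS]big_mkcond.
Qed.

Lemma sum_quad_char : \sum_x chi x = 0.
Proof.
pose U := [set x : R | x \is a GRing.unit].
have QU : Q \subset U by apply/subsetP=> z /unit_square_unit; rewrite inE.
(* The two indicator sums cancel because [2 * #|Q|] counts the units. *)
have chiE x : chi x = (x \in Q)%:R *+ 2 - (x \in U)%:R.
  rewrite /quad_char inE; have [Qx|nQx] := boolP (x \in Q).
    by rewrite unit_square_unit // mulr2n addrK.
  by rewrite mul0rn sub0r; case: ifP; rewrite ?oppr0.
rewrite (eq_bigr _ (fun x _ => chiE x)) sumrB sumrMnl !sum_mem.
by rewrite -card_unit_squares -mulrnA muln2 subrr.
Qed.

Lemma sum_ideal_mul (f : R -> F) c :
  (forall x, x \in M -> f x = c) -> \sum_x (x \in M)%:R * f x = #|M|%:R * c.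
Proof.
move=> fM; rewrite -sum_mem mulr_suml; apply: eq_bigr => x _.
by case: (boolP (x \in M)) => [/fM-> // | _]; rewrite !mul0r.
Qed.

(* For a unit z, substituting y = z / w turns the sum into that of
   chi (w - 1) over the units w. *)
Lemma sum_quad_char_sub z :
  \sum_y chi y * chi (z - y) =
  chi (-1) * (#|R|%:R * (z \in M)%:R - #|M|%:R).
Proof.
pose U := [set x : R | x \is a GRing.unit].
have chiN x : chi (- x) = chi (-1) * chi x by rewrite -quad_charM mulN1r.
have memU x : (x \in U)%:R = 1 - (x \in M)%:R :> F.
  by rewrite inE nonunitM; case: (_ \is a _); rewrite ?subr0 ?subrr.
have sumU (f : R -> F) :
    \sum_(x in U) f x = \sum_x f x - \sum_x (x \in M)%:R * f x.
  rewrite big_mkcond -sumrB; apply: eq_bigr => x _.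
  rewrite -[X in X - _]mul1r -mulrBl -memU.
  by case: ifP; rewrite ?mul1r ?mul0r.
have restrict (g : R -> F) : \sum_y chi y * g y = \sum_(y in U) chi y * g y.
  rewrite [RHS]big_mkcond; apply: eq_bigr => y _; rewrite inE.
  by case: ifPn => // nUy; rewrite quad_char_ideal ?nonunitM // mul0r.
rewrite restrict; have [Mz | nMz] := boolP (z \in M).
  (* For [z] in [M] every term is [chi y * chi (- y) = chi (-1)], summed over [#|R| - #|M|]
     units. *)
  rewrite mulr1 (eq_bigr (fun _ => chi (-1))) => [|y]; last first.
    rewrite inE => Uy; rewrite addrC quad_charDr // chiN mulrCA quad_char_sqr //.
    by rewrite mulr1.
  rewrite sumr_const card_unit -[LHS]mulr_natr natrB //.
  exact: max_card.
have Uz : z \is a GRing.unit by move: nMz; rewrite nonunitM negbK.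
(* Fixing the nonunits makes [z / w] an involution of all of [R], as [reindex_inj] requires. *)
pose h w := if w \is a GRing.unit then z / w else w.
have hK : involutive h.
  move=> w; rewrite /h; have [Uw | /negPf nUw] := boolP (w \is a GRing.unit).
    by rewrite unitrM Uz unitrV Uw invrM ?unitrV // invrK mulrCA mulrV ?mulr1.
  by rewrite nUw.
rewrite (reindex_inj (inv_inj hK)) (eq_bigl (fun w => w \in U)) => [|w]; last first.
  by rewrite !inE /h; case: ifP => // Uw; rewrite unitrM Uz unitrV Uw.
rewrite (eq_bigr (fun w => chi (w - 1))) => [|w]; last first.
  rewrite inE /h => Uw; rewrite Uw.
  have -> : z - z / w = z / w * (w - 1) by rewrite mulrBr mulr1 divrK.
  by rewrite (quad_charM (z / w)) mulrA quad_char_sqr ?mul1r // unitrM Uz unitrV.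
rewrite sumU (sum_ideal_mul (c := chi (-1))) => [|w Mw]; last first.
  by rewrite addrC quad_charDr.
have -> : \sum_x chi (x - 1) = 0.
  by rewrite -(reindex_inj (addIr (-1)) (P := xpredT) (F := chi)) sum_quad_char.
by rewrite mulr0 !sub0r mulrN mulrC.
Qed.

(** * The commutative algebra spanned by J, K, S and 1 *)

Local Notation J := (difference_mx (fun _ : R => 1 : F)).
Local Notation K := (difference_mx (fun x : R => (x \in M)%:R : F)).
Local Notation S := (difference_mx chi).
Local Notation n := (#|R|%:R : F).
Local Notation m := (#|M|%:R : F).

Lemma difference_mxZ a (f : R -> F) :
  a *: difference_mx f = difference_mx (fun x => a * f x).
Proof. by apply/matrixP=> i j; rewrite !mxE. Qed.

Lemma eq_difference_mx (f g : R -> F) :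
  f =1 g -> difference_mx f = difference_mx g.
Proof. by move=> fg; apply/matrixP=> i j; rewrite !mxE. Qed.

Lemma difference_mxJ (f : R -> F) : difference_mx f *m J = (\sum_x f x) *: J.
Proof.
rewrite difference_mxM difference_mxZ; apply: eq_difference_mx => x.
by rewrite mulr1; apply: eq_bigr => y _; rewrite mulr1.
Qed.

Lemma difference_mxK (f : R -> F) : (forall x z, z \in M -> f (x + z) = f x) ->
  difference_mx f *m K = m *: difference_mx f.
Proof.
move=> fM; rewrite difference_mxC difference_mxM difference_mxZ.
apply: eq_difference_mx => x; apply: sum_ideal_mul => y My.
by rewrite fM ?idealN.
Qed.

Lemma mul_SS : S *m S = (chi (-1) * n) *: K - (chi (-1) * m) *: J.
Proof.
rewrite difference_mxM; apply/matrixP=> i j; rewrite !mxE sum_quad_char_sub.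
by ring.
Qed.

(** Four coordinates on this algebra: matrix identities reduce to field identities between
    coefficients. *)
Definition comb a b c d : 'M[F]_#|R| := a *: J + b *: K + c *: S + d%:M.

Lemma comb_mul a b c d a' b' c' d' :
  comb a b c d *m comb a' b' c' d' =
  comb (n * a * a' + m * (a * b' + b * a') - chi (-1) * m * c * c'
          + a * d' + d * a')
       (m * b * b' + chi (-1) * n * c * c' + b * d' + d * b')
       (m * (b * c' + c * b') + c * d' + d * c') (d * d').
Proof.
have JJ : J *m J = n *: J.
  by rewrite difference_mxJ sumr_const.
have SJ : S *m J = 0 by rewrite difference_mxJ sum_quad_char scale0r.
have KJ : K *m J = m *: J by rewrite difference_mxJ sum_mem.
have KK : K *m K = m *: K.
  by apply: difference_mxK => x z Mz; rewrite idealDr.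
have SK : S *m K = m *: S by apply: difference_mxK; apply: quad_charDr.
have JS : J *m S = 0 by rewrite difference_mxC.
have JK : J *m K = m *: J by rewrite difference_mxC.
have KS : K *m S = m *: S by rewrite difference_mxC.
rewrite /comb !mulmxDl !mulmxDr -!scalemxAl -!scalemxAr.
rewrite !mul_scalar_mx !mul_mx_scalar.
rewrite JJ SJ KJ KK SK JS JK KS mul_SS scale_scalar_mx.
by apply/matrixP=> i j; rewrite !mxE; ring.
Qed.

Lemma combZ x a b c d : x *: comb a b c d =
  comb (x * a) (x * b) (x * c) (x * d).
Proof. by apply/matrixP=> i j; rewrite !mxE; ring. Qed.

Lemma combD a b c d a' b' c' d' :
  comb a b c d + comb a' b' c' d' = comb (a + a') (b + b') (c + c') (d + d').
Proof. by apply/matrixP=> i j; rewrite !mxE; ring. Qed.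

Lemma comb0 : comb 0 0 0 0 = 0.
Proof. by apply/matrixP=> i j; rewrite !mxE; ring. Qed.

Lemma mxtrace_comb a b c d : \tr (comb a b c d) = n * (a + b + d).
Proof.
rewrite !raddfD /= !mxtraceZ mxtrace_scalar !mxtrace_difference ideal0.
rewrite quad_char_ideal ?ideal0 // -[d *+ _]mulr_natl.
rewrite !mulr1 mulr0; ring.
Qed.

End LocalRing.

(** * The spectra in the two residue cases *)

Lemma prodr_nseq (A : pzSemiRingType) (I : Type) (k : nat) (x : I)
    (f : I -> A) :
  \prod_(i <- nseq k x) f i = f x ^+ k.
Proof. by rewrite big_nseq iter_mulr_1. Qed.

Theorem theorem2p4 (F : rcfType) (R : finComUnitRingType) (M : {set R})
    (m : nat) (localR : local_ring R) (maxM : maximal_ideal M)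
    (cardM : #|M| = m) :
  ((#|R| %/ m = 1 %[mod 4])%N ->
    has_spectrum (@quadratic_unitary_cayley R)
      (nseq 1 ((#|R|%:R - m%:R) / 2 : F)
       ++ nseq ((#|R| %/ m - 1) %/ 2)%N
            (m%:R * (-1 + Num.sqrt (#|R|%:R / m%:R)) / 2)
       ++ nseq ((#|R| %/ m - 1) %/ 2)%N
            (m%:R * (-1 - Num.sqrt (#|R|%:R / m%:R)) / 2)
       ++ nseq (#|R| - #|R| %/ m)%N 0))
  /\
  ((#|R| %/ m = 3 %[mod 4])%N ->
    has_spectrum (@quadratic_unitary_cayley R)
      (nseq 1 (#|R|%:R - m%:R : F)
       ++ nseq (#|R| %/ m - 1)%N (- m%:R)
       ++ nseq (#|R| - #|R| %/ m)%N 0)).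
Proof.
have idealM : idealr_closed M by case: maxM.
have nonunitM x : (x \in M) = (x \isn't a GRing.unit).
  exact: maximal_ideal_nonunit.
have m_gt0 : (0 < m)%N by rewrite -cardM card_ideal_gt0.
set q := (#|R| %/ m)%N.
have cardR : #|R| = (q * m)%N.
  by rewrite /q -cardM divnK ?card_ideal_dvdn.
have q_gt0 : (0 < q)%N.
  rewrite lt0n; apply: contraTneq m_gt0 => q0; move: (max_card (mem M)).
  by rewrite cardM cardR q0 mul0n leqn0 => /eqP->.
have le_qR : (q <= #|R|)%N by rewrite cardR leq_pmulr.
have mF0 : m%:R != 0 :> F by rewrite pnatr_eq0 -lt0n.
have qF0 : q%:R != 0 :> F by rewrite pnatr_eq0 -lt0n.
have oddq_facts : odd q ->
    (2 : R) \is a GRing.unit /\ #|unit_squares R|.*2 = ((q - 1) * m)%N.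
  rewrite /q -cardM => oddq; have u2 := unit2_of_odd_index idealM nonunitM oddq.
  split=> //; rewrite (card_unit_squares idealM nonunitM u2) (card_unit nonunitM).
  by rewrite cardM -/q mulnBl mul1n -cardR.
have adjE : adjacency_mx F (@quadratic_unitary_cayley R) =
    difference_mx (fun x => (x \in signed_unit_squares R)%:R).
  by apply/matrixP=> i j; rewrite !mxE.
(* The indicator of the squares is half the sum of the indicator of the units and [chi]. *)
have chi_ind (x : R) : (x \in unit_squares R)%:R =
    2^-1 * (1 - (x \in M)%:R + quad_char F x).
  rewrite /quad_char nonunitM; have [Qx|nQx] := boolP (x \in unit_squares R).
    rewrite unit_square_unit //=; by field.
  by case: (x \is a GRing.unit) => /=; field.
pose cmb := @comb R M F.
split=> q4.
  have [k qE] : exists k, q = (k * 4).+1.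
    by exists (q %/ 4)%N; rewrite {1}(divn_eq q 4) q4 addn1.
  have oddq : odd q by rewrite qE /= oddM andbF.
  have [u2 cardQ] := oddq_facts oddq.
  (* Here [q - 1 = 4k], so there are [2km] squares, an even number. *)
  have Q1 : -1 \in unit_squares R.
    rewrite (unit_squareN1 idealM nonunitM u2).
    have -> : #|unit_squares R| = (k * m).*2.
      apply/double_inj; rewrite cardQ qE subn1 /= -!muln2; ring.
    by rewrite odd_double.
  have TE : signed_unit_squares R =i unit_squares R.
    move=> x; rewrite inE; apply/orP/idP; last by left.
    case=> [//|/imsetP[y Qy ->]].
    by rewrite -mulN1r unit_squareM.
  have chi1 : quad_char F (-1 : R) = 1 by rewrite /quad_char Q1 unitrN1.
  set r := Num.sqrt _.
  have r2 : r ^+ 2 = q%:R.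
    by rewrite sqr_sqrtr ?divr_ge0 ?ler0n // cardR natrM mulfK.
  have r0 : r != 0 by apply: contraNneq qF0 => r0; rewrite -r2 r0 expr0n.
  pose n : F := #|R|%:R; pose mF : F := m%:R.
  (* Eliminating [n] leaves identities in [r] and [mF] that [field] can decide. *)
  have nE : n = r ^+ 2 * mF by rewrite /n cardR natrM r2.
  (* [J / n] projects onto constants, and [1 - K / m] onto functions with zero sum on each coset of
     [M]. The remaining [P = K / m - J / n] satisfies [S^2 = (m r)^2 P], so it splits as
     [(P + S / (m r)) / 2] and [(P - S / (m r)) / 2]. *)
  pose s := [:: ((n - mF) / 2, cmb n^-1 0 0 0);
    (mF * (-1 + r) / 2, cmb (- (2 * n)^-1) (2 * mF)^-1 (2 * mF * r)^-1 0);
    (mF * (-1 - r) / 2, cmb (- (2 * n)^-1) (2 * mF)^-1 (- (2 * mF * r)^-1) 0);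
    (0, cmb 0 (- mF^-1) 0 1)].
  have A_s : adjacency_mx F (@quadratic_unitary_cayley R) =
      \sum_(p <- s) p.1 *: p.2.
    rewrite !big_cons big_nil /= !combZ addr0 !combD adjE.
    apply/matrixP=> i j; rewrite !mxE TE chi_ind nE; field.
    by rewrite mF0 r0.
  have sum_s : \sum_(p <- s) p.2 = 1%:M.
    rewrite !big_cons big_nil /= addr0 !combD.
    apply/matrixP=> i j; rewrite !mxE nE; field.
    by rewrite mF0 r0.
  have orth_s : orthogonal_idempotents s.
    rewrite /orthogonal_idempotents /= !comb_mul // chi1 cardM -/n -/mF nE.
    (* With 0 written as a [comb], every required product is compared coefficient by coefficient. *)
    rewrite -(comb0 M F) !andbT.
    by repeat (apply/andP; split); apply/eqP; congr comb; field;
       rewrite ?mF0 ?r0.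
  rewrite /has_spectrum A_s char_poly_orthogonal // !big_cat /= !prodr_nseq.
  rewrite !big_cons big_nil /= mulr1.
  (* The division is exact as [q - 1 = 4k]; the value is the trace of each of the two middle
     idempotents. *)
  have halfq : ((q - 1) %/ 2)%:R = (r ^+ 2 - 1) / 2 :> F.
    rewrite r2 qE subn1 /= (_ : k * 4 = k * 2 * 2)%N ?mulnK // -?mulnA //.
    by rewrite -addn1 natrD !natrM; field.
  have in_s i := @mem_nth _ (0, 0) s i.
  have trE a b c d : \tr (cmb a b c d) = n * (a + b + d).
    exact: mxtrace_comb.
  rewrite (rank_orthogonal (k := 1%N) orth_s (mem_head _ _)); last first.
    by rewrite trE nE; field; rewrite mF0 r0.
  rewrite (rank_orthogonal (k := ((q - 1) %/ 2)%N) orth_s (in_s 1 isT)); last first.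
    by rewrite trE nE halfq; field; rewrite mF0 r0.
  rewrite (rank_orthogonal (k := ((q - 1) %/ 2)%N) orth_s (in_s 2 isT)); last first.
    by rewrite trE nE halfq; field; rewrite mF0 r0.
  rewrite (rank_orthogonal (k := (#|R| - q)%N) orth_s (in_s 3 isT)); last first.
    by rewrite trE natrB // -/n nE r2; field; rewrite mF0.
  by rewrite big_nil mulr1 expr1.
have [k qE] : exists k, q = (k * 4).+3.
  by exists (q %/ 4)%N; rewrite {1}(divn_eq q 4) q4 addn3.
have oddq : odd q by rewrite qE /= oddM andbF.
have [u2 cardQ] := oddq_facts oddq.
(* Now [q - 1 = 4k + 2], so there are [(2k + 1) m] squares, an odd number because [m] is odd. *)
have N1Q : -1 \notin unit_squares R.
  rewrite (unit_squareN1 idealM nonunitM u2) negbK.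
  have -> : #|unit_squares R| = ((k * 2).+1 * m)%N.
    apply/double_inj; rewrite cardQ qE subn1 /= -!muln2; ring.
  by rewrite oddM /= oddM andbF -cardM odd_card_ideal.
(* Since -1 is a nonsquare, each unit [x] has [x] or [- x] in [Q], so the connection set is all
   units. *)
have TE x : (x \in signed_unit_squares R) = (x \notin M).
  rewrite nonunitM negbK inE; apply/orP/idP=> [[/unit_square_unit //|] | Ux].
    by case/imsetP=> y /unit_square_unit Uy ->; rewrite unitrN.
  have [|nQx] := boolP (x \in unit_squares R); [by left | right].
  apply/imsetP; exists (- x); last by rewrite opprK.
  by rewrite -mulN1r (mul_nonsquare idealM nonunitM u2) ?unitrN1.
pose n : F := #|R|%:R; pose mF : F := m%:R.
have nE : n = q%:R * mF by rewrite /n cardR natrM.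
(* The matrix [J - K] does not involve [S], so [K / m - J / n] stays whole, with eigenvalue [- m]
   and trace [q - 1]. *)
pose s := [:: (n - mF, cmb n^-1 0 0 0); (- mF, cmb (- n^-1) mF^-1 0 0);
  (0, cmb 0 (- mF^-1) 0 1)].
have A_s : adjacency_mx F (@quadratic_unitary_cayley R) =
    \sum_(p <- s) p.1 *: p.2.
  rewrite !big_cons big_nil /= !combZ addr0 !combD adjE.
  apply/matrixP=> i j; rewrite !mxE TE nE.
  have -> : (enum_val i - enum_val j \notin M)%:R =
      1 - (enum_val i - enum_val j \in M)%:R :> F.
    by case: (_ \in M); rewrite ?subrr ?subr0.
  by field; rewrite mF0 qF0.
have sum_s : \sum_(p <- s) p.2 = 1%:M.
  rewrite !big_cons big_nil /= addr0 !combD.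
  apply/matrixP=> i j; rewrite !mxE nE; field.
  by rewrite mF0 qF0.
have orth_s : orthogonal_idempotents s.
  rewrite /orthogonal_idempotents /= !comb_mul // cardM -/n -/mF nE.
  rewrite -(comb0 M F) !andbT.
  by repeat (apply/andP; split); apply/eqP; congr comb; field;
     rewrite ?mF0 ?qF0.
rewrite /has_spectrum A_s char_poly_orthogonal // !big_cat /= !prodr_nseq.
rewrite !big_cons big_nil /= mulr1.
have in_s i := @mem_nth _ (0, 0) s i.
have trE a b c d : \tr (cmb a b c d) = n * (a + b + d).
  exact: mxtrace_comb.
rewrite (rank_orthogonal (k := 1%N) orth_s (mem_head _ _)); last first.
  by rewrite trE nE; field; rewrite mF0 qF0.
rewrite (rank_orthogonal (k := (q - 1)%N) orth_s (in_s 1 isT)); last first.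
  by rewrite trE nE natrB //; field; rewrite mF0 qF0.
rewrite (rank_orthogonal (k := (#|R| - q)%N) orth_s (in_s 2 isT)); last first.
  by rewrite trE natrB // -/n nE; field; rewrite mF0.
by rewrite big_nil mulr1 expr1.
Qed.
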